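(* Let $a(n)$ denote the number of partitions of the nonnegative integer $n$ in which every part appears with odd multiplicity. Let $m\ge 0$ be an integer and write the prime factorization of $4m+1$ as $4m+1=\prod_{i\ge 1}p_i^{\alpha_i}$. Then $a(4m+1)$ is odd if and only if one of the following holds: (1) $m\equiv 0\pmod 3$ and $4m+1$ is a perfect square; or (2) $m\equiv 1\pmod 3$, and all exponents $\alpha_i$ are even except for exactly one of them, which is congruent to $1\pmod 4$.
   Context: A partition of $n$ is a finite nonincreasing sequence of positive integers (parts) summing to $n$; the multiplicity of a part is the number of times it occurs. Equivalently, $\sum_{n\ge0}a(n)q^n=\prod_{i\ge1}\left(1+\frac{q^i}{1-q^{2i}}\right)$. *)

(* Defs.v *)
From HB Require Import structures.
From mathcomp Require Import all_boot.

Set Implicit Arguments.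
Unset Strict Implicit.
Unset Printing Implicit Defensive.

Definition is_partition (n : nat) (s : seq nat) : bool :=
  [&& sorted geq s, all (leq 1) s & sumn s == n].

Definition odd_multiplicities (s : seq nat) : bool :=
  all (fun i => odd (count_mem i s)) s.

(* A partition of n has at most n parts, each at most n, so the finite type
   n.-bseq 'I_n.+1 contains all of them; see partition_bounded. *)
Definition a (n : nat) : nat :=
  #|[set t : n.-bseq 'I_n.+1 |
      is_partition n (map val t) && odd_multiplicities (map val t)]|.

Lemma partition_bounded (n : nat) (s : seq nat) :
  is_partition n s -> exists t : n.-bseq 'I_n.+1, map val t = s.
Proof.
case/and3P=> _ s_gt0 /eqP sum_s.
have size_s : size s <= n.
  rewrite -{}sum_s; elim: s s_gt0 => //= x s IHs /andP[x_gt0 /IHs le_s].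
  by rewrite -add1n leq_add.
have lt_s : all (ltn^~ n.+1) s.
  apply/allP=> x; rewrite -{}sum_s {s_gt0 size_s}.
  elim: s => //= y s IHs; rewrite inE ltnS => /predU1P[->|/IHs].
    exact: leq_addr.
  by rewrite ltnS => /leq_trans; apply; apply: leq_addl.
have val_t : map val (map (@inord n) s) = s.
  rewrite -map_comp -[RHS]map_id; apply/eq_in_map=> x /(allP lt_s) lt_x /=.
  exact: inordK.
have size_t : size (map (@inord n) s) <= n by rewrite size_map.
by exists (Bseq size_t).
Qed.

Definition perfect_square (n : nat) : Prop := exists k : nat, n = k ^ 2.

(* Main.v *)
(* Modulo 2 the generating function is f_3 / f_1^3, where f_k = prod (1 - q^(k i)).
   As f_1^4 = f_4 modulo 2, it equals f_1 f_3 / f_4. By Euler's pentagonal number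
   theorem f_1 = sum q^((u^2 - 1) / 24) over u > 0 prime to 6, so the coefficients of
   f_1 f_3 count solutions of u^2 + 3 v^2 = 4 M with u, v odd. Multiplication by sixth
   roots of unity in Z[(1 + sqrt(-3)) / 2] permutes these solutions; it shows that the
   coefficients at exponents 4 m + 1 form f_3 f_4, and that f_4 = f_1 psi with
   psi = sum q^((v^2 - 1) / 8) over odd v > 0. Hence sum a(4m+1) q^m = psi f_3, i.e.
   a(4m+1) has the parity of the number of x^2 + y^2 = 2 (4m+1) with x, y > 0 odd and
   y prime to 3. There is none if m = 2 mod 3; exchanging x and y settles m = 0 mod 3.
   If m = 1 mod 3 these are the representations 4m+1 = u^2 + 4 v^2, and Zagier's
   involution shows that their number has the parity of half the number of divisors
   of 4m+1. *)
Require Import Defs.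
From mathcomp Require Import all_boot all_algebra.
From mathcomp Require Import zify ring.

Set Implicit Arguments.
Unset Strict Implicit.
Unset Printing Implicit Defensive.

(** * Parity of counts *)

Lemma odd_size_involution (T : eqType) (f : T -> T) (s : seq T) :
  uniq s -> {in s, forall x, f x \in s} -> {in s, forall x, f (f x) = x} ->
  odd (size s) = odd (count (fun x => f x == x) s).
Proof.
have [n] := ubnP (size s); elim: n s => // n IHn [|x s] //= le_s /andP[xs us] fs ffs.
have fin y : y \in s -> f y != x -> f y \in s.
  by move=> ys yx; have := fs y; rewrite !inE ys orbT (negPf yx); apply.
have [fx|fx] := eqVneq (f x) x.
  rewrite /= IHn //; last by move=> y ys; apply: ffs; rewrite inE ys orbT.
  move=> y ys; apply: fin => //; apply: contraNneq xs => fy.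
  by rewrite -fx -fy ffs // inE ys orbT.
have fxs : f x \in s by have := fs x; rewrite !inE eqxx (negPf fx); apply.
have ffx : f (f x) = x by rewrite ffs // inE eqxx.
have /permP sE := perm_to_rem fxs.
rewrite sE /= ffx [x == f x]eq_sym (negPf fx) /= (perm_size (perm_to_rem fxs)) /= negbK.
apply: IHn; first by rewrite size_rem //; lia.
- exact: rem_uniq.
- move=> y; rewrite !mem_rem_uniq // !inE => /andP[yfx ys].
  have ny : f y != x.
    by apply: contraNneq yfx => <-; rewrite ffs // inE ys orbT.
  rewrite fin // andbT; apply: contraNneq xs => /(congr1 f).
  by rewrite ffx ffs ?inE ?ys ?orbT // => <-.
- by move=> y /mem_rem ys; apply: ffs; rewrite inE ys orbT.
Qed.

(** The list [s] is only a finite range containing all of [P], and [f] may leave it outside [P]; so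
    arithmetic maps can be used on boxes. *)
Lemma odd_count_involution (T : eqType) (f : T -> T) (P : pred T) (s : seq T) :
  uniq s -> (forall x, P x -> x \in s) -> (forall x, P x -> P (f x)) ->
  (forall x, P x -> f (f x) = x) ->
  odd (count P s) = odd (count (fun x => P x && (f x == x)) s).
Proof.
move=> us Ps Pf ff; rewrite -size_filter (@odd_size_involution _ f) ?filter_uniq //.
- by rewrite count_filter; congr odd; apply: eq_count => x /=; rewrite andbC.
- by move=> x; rewrite !mem_filter => /andP[Px _]; rewrite Pf //= Ps // Pf.
- by move=> x; rewrite mem_filter => /andP[Px _]; apply: ff.
Qed.

Lemma count_le_inj (T U : eqType) (f : T -> U) (P : pred T) (Q : pred U) s t :
  uniq s -> (forall y, Q y -> y \in t) ->
  (forall x, P x -> Q (f x)) ->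
  (forall x y, P x -> P y -> f x = f y -> x = y) -> count P s <= count Q t.
Proof.
move=> us Qt PQ fI; rewrite -!size_filter -(size_map f); apply: uniq_leq_size.
  rewrite map_inj_in_uniq ?filter_uniq // => x y.
  by rewrite !mem_filter => /andP[Px _] /andP[Py _]; apply: fI.
move=> y /mapP[x]; rewrite mem_filter => /andP[Px _] ->.
by rewrite mem_filter PQ // Qt // PQ.
Qed.

Lemma count_bij (T U : eqType) (f : T -> U) (g : U -> T) (P : pred T) (Q : pred U) s t :
  uniq s -> uniq t -> (forall x, P x -> x \in s) -> (forall y, Q y -> y \in t) ->
  (forall x, P x -> Q (f x) /\ g (f x) = x) ->
  (forall y, Q y -> P (g y) /\ f (g y) = y) -> count P s = count Q t.
Proof.
move=> us ut Ps Qt Pf Qg; apply/eqP; rewrite eqn_leq; apply/andP; split.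
  apply: (@count_le_inj _ _ f) => // x; first by case/Pf.
  by move=> y /Pf[_ {2}<-] /Pf[_ {2}<-] ->.
apply: (@count_le_inj _ _ g) => // x; first by case/Qg.
by move=> y /Qg[_ {2}<-] /Qg[_ {2}<-] ->.
Qed.

(** * Representations by u ^ 2 + 3 v ^ 2 *)

Definition box (L : nat) : seq (nat * nat) := [seq (u, v) | u <- iota 0 L, v <- iota 0 L].

Lemma box_uniq L : uniq (box L).
Proof. by apply: allpairs_uniq; rewrite ?iota_uniq // => -[? ?] [? ?] _ _ [-> ->]. Qed.

Lemma mem_box L x : (x \in box L) = (x.1 < L) && (x.2 < L).
Proof.
apply/allpairsP/idP => [[[u v] [/= + + ->]]|/andP[xL yL]].
  by rewrite !mem_iota !add0n => /andP[_ ->] /andP[_ ->].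
by exists x; rewrite !mem_iota; split=> //; case: x {xL yL}.
Qed.

(* Multiplication of u + v * sqrt(-3) by a primitive sixth root of unity, the
   root being chosen so that the result has odd coordinates, followed by absolute
   values; (x - y) + (y - x) is |x - y| since subtraction is truncated. *)
Definition eis (x : nat * nat) : nat * nat :=
  if 4 %| x.1 + 3 * x.2
  then (((x.1 - 3 * x.2) + (3 * x.2 - x.1)) %/ 2, (x.1 + x.2) %/ 2)
  else ((x.1 + 3 * x.2) %/ 2, ((x.1 - x.2) + (x.2 - x.1)) %/ 2).

Definition odd_eis_rep (M : nat) (x : nat * nat) :=
  [&& odd x.1, odd x.2 & x.1 ^ 2 + 3 * x.2 ^ 2 == 4 * M].

Lemma absdiff_cases u v :
  (exists2 k, v = u + k & u - v + (v - u) = k) \/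
  (exists2 k, u = v + k & u - v + (v - u) = k).
Proof.
have [le|le] := leqP u v; [left; exists (v - u)|right; exists (u - v)]; lia.
Qed.

Lemma absdiff_sqr u v : (u - v + (v - u)) ^ 2 + 2 * (u * v) = u ^ 2 + v ^ 2.
Proof. by case: (absdiff_cases u v) => -[k -> ->]; lia. Qed.

(** Multiplying u + v sqrt(-3) by 1 + sqrt(-3) or 1 - sqrt(-3) multiplies the norm by 4, and halving
    the coordinates restores it. For odd u, v the test modulo 4 selects the sign for which both
    halves are odd. *)
Lemma odd_eis_rep_eis M x : odd_eis_rep M x -> odd_eis_rep M (eis x).
Proof.
case: x => u v; rewrite /odd_eis_rep /eis /= => /and3P[ou ov /eqP E].
case: ifP => /= h.
  have := absdiff_sqr u (3 * v); set d := u - 3 * v + (3 * v - u) => D.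
  have [d' dE] : exists d', d = 2 * d' by exists (d %/ 2); lia.
  have [e eE] : exists e, u + v = 2 * e by exists ((u + v) %/ 2); lia.
  have -> : d %/ 2 = d' by lia.
  have -> : (u + v) %/ 2 = e by lia.
  apply/and3P; split; [lia|lia|apply/eqP].
  have : d ^ 2 + 3 * (u + v) ^ 2 = 4 * (u ^ 2 + 3 * v ^ 2).
    by move: D; clear; rewrite expnMn sqrnD; lia.
  rewrite E dE eE !expnMn; clear; lia.
have := absdiff_sqr u v; set d := u - v + (v - u) => D.
have [d' dE] : exists d', d = 2 * d' by exists (d %/ 2); lia.
have [e eE] : exists e, u + 3 * v = 2 * e by exists ((u + 3 * v) %/ 2); lia.
have -> : d %/ 2 = d' by lia.
have -> : (u + 3 * v) %/ 2 = e by lia.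
apply/and3P; split; [lia|lia|apply/eqP].
have : (u + 3 * v) ^ 2 + 3 * d ^ 2 = 4 * (u ^ 2 + 3 * v ^ 2).
  by move: D; clear; rewrite sqrnD expnMn; lia.
rewrite E dE eE !expnMn; clear; lia.
Qed.

Lemma eisK M x : odd_eis_rep M x -> eis (eis x) = x.
Proof.
case: x => u v; rewrite /odd_eis_rep /= => /and3P[ou ov _].
rewrite {2}/eis /=; case: ifP => h; rewrite /eis /=; case: ifP => h'; congr pair; lia.
Qed.

(** A fixed point of [eis] has u = v or u = 3 v. The first gives u ^ 2 = M; the second gives M = 3 v
    ^ 2, which is excluded. *)
Lemma odd_count_eis L M : 4 * M < L ^ 2 -> ~~ (3 %| M) ->
  odd (count (odd_eis_rep M) (box L)) = odd (count (fun u => odd u && (u ^ 2 == M)) (iota 0 L)).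
Proof.
move=> ML M3.
rewrite (@odd_count_involution _ eis) ?box_uniq //.
- congr odd; apply: (@count_bij _ _ (fun x => x.1) (fun u => (u, u)));
    rewrite ?box_uniq ?iota_uniq //.
  + case=> u v; rewrite mem_box /odd_eis_rep /= => /andP[/and3P[_ _ /eqP E] _]. nia.
  + move=> u /andP[_ /eqP E]; rewrite mem_iota; nia.
  + case=> u v /andP[]; rewrite /odd_eis_rep /eis /= => /and3P[ou ov /eqP E].
    case: ifP => h /eqP [h1 h2].
      have uv : u = v by lia.
      subst v; split=> //; rewrite ou /=; apply/eqP; lia.
    have uv : u = 3 * v by lia.
    subst u; exfalso; move/negP: M3; apply; apply/dvdnP; exists (v ^ 2). nia.
  + move=> u /andP[ou /eqP E]; split=> //; rewrite /odd_eis_rep /eis /= ou /=.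
    apply/andP; split; first by apply/eqP; lia.
    have -> : 4 %| u + 3 * u by lia.
    apply/eqP; congr pair; lia.
- case=> u v; rewrite mem_box /odd_eis_rep /= => /and3P[_ _ /eqP E]. nia.
- exact: odd_eis_rep_eis.
- exact: eisK.
Qed.

Lemma sqr_odd_mod8 u : odd u -> exists k, u ^ 2 = 8 * k + 1.
Proof.
move=> ou; have [k ->] : exists k, u = k.*2.+1 by exists u./2; lia.
have := oddM k k.+1; rewrite oddS andbN => ev.
exists ((k * k.+1)./2); nia.
Qed.

Lemma sqr_even u : ~~ odd u -> exists k, u ^ 2 = 4 * k.
Proof. by move=> eu; exists (u./2 ^ 2); rewrite -[4]/(2 ^ 2) -expnMn; congr (_ ^ 2); lia. Qed.

Lemma sqr_mod3 u : ~~ (3 %| u) -> exists k, u ^ 2 = 3 * k + 1.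
Proof.
move=> u3; have [[k ->]|[k ->]] : (exists k, u = 3 * k + 1) \/ exists k, u = 3 * k + 2.
- have [|] := eqVneq (u %% 3) 1; [left|right]; exists (u %/ 3); lia.
- by exists (3 * k ^ 2 + 2 * k); lia.
- by exists (3 * k ^ 2 + 4 * k + 1); lia.
Qed.

Lemma sqr_dvd3 u : 3 %| u -> exists k, u ^ 2 = 9 * k.
Proof. by case/dvdnP=> k ->; exists (k ^ 2); lia. Qed.

(* Exactly for these u is (u ^ 2 - 1) / 24 an integer, a generalized pentagonal number. *)
Definition prime_to6 u := odd u && ~~ (3 %| u).

Definition eis_half_rep m (x : nat * nat) :=
  prime_to6 x.2 && (4 * x.1 ^ 2 + 3 * x.2 ^ 2 == 24 * m + 7).

(* If u, v are odd, (u + v * sqrt(-3)) / 2 has an associate a + b * sqrt(-3) with a, b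
   integers; a is even when the norm is 7 mod 24, and the value is (|a| / 2, |b|). *)
Definition eis_half (x : nat * nat) : nat * nat :=
  if 4 %| x.1 + 3 * x.2
  then ((x.1 + 3 * x.2) %/ 8, ((x.1 - x.2) + (x.2 - x.1)) %/ 4)
  else (((x.1 - 3 * x.2) + (3 * x.2 - x.1)) %/ 8, (x.1 + x.2) %/ 4).

(** Inverse of [eis_half]: a + b sqrt(-3) is multiplied by 1 + sqrt(-3) or 1 - sqrt(-3). As a and b
    are prime to 3 on [eis_half_rep], exactly one sign makes the second coordinate divisible by
    3. *)
Definition eis_double (x : nat * nat) : nat * nat :=
  let a := 2 * x.1 in let b := x.2 in
  if 3 %| a + b then ((a - 3 * b) + (3 * b - a), a + b)
  else (a + 3 * b, (a - b) + (b - a)).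

Lemma eis_norm_even m A b : A ^ 2 + 3 * b ^ 2 = 24 * m + 7 -> odd b /\ ~~ odd A.
Proof.
case: (boolP (odd b)) => [/sqr_odd_mod8[k ->]|/sqr_even[k ->]];
case: (boolP (odd A)) => [/sqr_odd_mod8[l ->]|/sqr_even[l ->]]; lia.
Qed.

Lemma eis_halfK m x : odd_eis_rep (24 * m + 7) x -> 3 %| x.2 ->
  eis_half_rep m (eis_half x) /\ eis_double (eis_half x) = x.
Proof.
case: x => u v; rewrite /odd_eis_rep /eis_half /eis_half_rep /prime_to6 /=.
move=> /and3P[ou ov /eqP E] v3.
have u3 : ~~ (3 %| u).
  by apply/negP => /sqr_dvd3[k kE]; case: (sqr_dvd3 v3) => l lE; lia.
case: ifP => /= h.
  have := absdiff_sqr u v; set d := u - v + (v - u) => D.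
  have [b dE] : exists b, d = 4 * b by exists (d %/ 4); lia.
  have [A eE] : exists A, u + 3 * v = 4 * A by exists ((u + 3 * v) %/ 4); lia.
  have N : A ^ 2 + 3 * b ^ 2 = 24 * m + 7.
    have : (u + 3 * v) ^ 2 + 3 * d ^ 2 = 4 * (u ^ 2 + 3 * v ^ 2).
      by move: D; clear; rewrite sqrnD expnMn; lia.
    rewrite E dE eE !expnMn; clear; lia.
  have [ob eA] := eis_norm_even N; move: N; clear E D => N.
  have [s sE] : exists s, A = 2 * s by exists A./2; clear N; lia.
  have -> : (u + 3 * v) %/ 8 = s by clear N; lia.
  have -> : d %/ 4 = b by clear N; lia.
  split; last by rewrite /eis_double /=; case: ifP => h3; congr pair; clear N; lia.
  apply/andP; split; first by rewrite ob; clear N; lia.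
  by apply/eqP; rewrite -N sE expnMn.
have := absdiff_sqr u (3 * v); set d := u - 3 * v + (3 * v - u) => D.
have [A dE] : exists A, d = 4 * A by exists (d %/ 4); lia.
have [b eE] : exists b, u + v = 4 * b by exists ((u + v) %/ 4); lia.
have N : A ^ 2 + 3 * b ^ 2 = 24 * m + 7.
  have : d ^ 2 + 3 * (u + v) ^ 2 = 4 * (u ^ 2 + 3 * v ^ 2).
    by move: D; clear; rewrite expnMn sqrnD; lia.
  rewrite E dE eE !expnMn; clear; lia.
have [ob eA] := eis_norm_even N; move: N; clear E D => N.
have [s sE] : exists s, A = 2 * s by exists A./2; clear N; lia.
have -> : d %/ 8 = s by clear N; lia.
have -> : (u + v) %/ 4 = b by clear N; lia.
split; last by rewrite /eis_double /=; case: ifP => h3; congr pair; clear N; lia.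
apply/andP; split; first by rewrite ob; clear N; lia.
by apply/eqP; rewrite -N sE expnMn.
Qed.

Lemma eis_doubleK m x : eis_half_rep m x ->
  (odd_eis_rep (24 * m + 7) (eis_double x) && (3 %| (eis_double x).2)) /\
  eis_half (eis_double x) = x.
Proof.
case: x => s t; rewrite /eis_half_rep /prime_to6 /= => /andP[/andP[ot t3] /eqP E].
have s3 : ~~ (3 %| s).
  by apply/negP => /sqr_dvd3[k kE]; lia.
have os : odd s.
  by apply/negPn/negP => /sqr_even[k kE]; case: (sqr_odd_mod8 ot) => l lE; lia.
rewrite /eis_double /odd_eis_rep /=; case: ifP => /= h.
  split.
    have := absdiff_sqr (2 * s) (3 * t); set d := _ - _ + _ => D.
    apply/andP; split; last by [].
    apply/and3P; split; [lia|lia|apply/eqP].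
    rewrite sqrnD; move: D E; rewrite !expnMn; clear; lia.
  by rewrite /eis_half /=; case: ifP => h4; congr pair; lia.
split.
  have := absdiff_sqr (2 * s) t; set d := _ - _ + _ => D.
  apply/andP; split; last by lia.
  apply/and3P; split; [lia|lia|apply/eqP].
  rewrite sqrnD; move: D E; rewrite !expnMn; clear; lia.
by rewrite /eis_half /=; case: ifP => h4; congr pair; lia.
Qed.

(** An odd square is 1 modulo 8, so 24 m + 7 is none and [odd_count_eis] makes the number of all odd
    representations even. Those with 3 dividing v thus have the same parity as the others, and
    [eis_half] maps them bijectively to [eis_half_rep]. *)
Lemma odd_count_eis_prime_to6 L m : 4 * (24 * m + 7) < L ^ 2 ->
  odd (count (fun x => odd_eis_rep (24 * m + 7) x && ~~ (3 %| x.2)) (box L)) =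
  odd (count (eis_half_rep m) (box L)).
Proof.
move=> mL; have M3 : ~~ (3 %| 24 * m + 7) by lia.
have := odd_count_eis mL M3.
rewrite [count _ (iota 0 L)](_ : _ = 0); last first.
  apply/eqP; rewrite -leqn0 leqNgt -has_count; apply/hasPn => u _.
  apply/negP => /andP[/sqr_odd_mod8[k ->] /eqP E]. clear -E; lia.
have -> : count (eis_half_rep m) (box L) =
  count (fun x => odd_eis_rep (24 * m + 7) x && (3 %| x.2)) (box L).
  apply: (@count_bij _ _ eis_double eis_half); rewrite ?box_uniq //.
  - case=> s t; rewrite mem_box /eis_half_rep /= => /andP[_ /eqP E]. nia.
  - case=> u v; rewrite mem_box /odd_eis_rep /= => /andP[/and3P[_ _ /eqP E] _]. nia.
  - by move=> x /eis_doubleK.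
  - by move=> x /andP[] /eis_halfK.
set A := count _ _ => + ; set B := count _ _; set C := count _ _.
have -> : A = B + C.
  rewrite /A /B /C; elim: (box L) => //= x s ->.
  by case: (odd_eis_rep _ x); case: (3 %| x.2) => /=; lia.
by rewrite oddD; case: (odd B); case: (odd C).
Qed.

(** * Divisors *)

(** Every divisor is p ^ i * d with i <= k and d dividing n, and [logn p] recovers i. *)
Lemma size_divisors_prime_pow p k n :
  prime p -> 0 < n -> ~~ (p %| n) -> size (divisors (p ^ k * n)) = k.+1 * size (divisors n).
Proof.
move=> p_pr n0 pn; have p0 := prime_gt0 p_pr.
rewrite -[in RHS](size_iota 0 k.+1) -(size_allpairs pair).
rewrite -[RHS](size_map (fun x => p ^ x.1 * x.2)); apply/perm_size/uniq_perm.
  exact: divisors_uniq.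
  rewrite map_inj_in_uniq; first by rewrite allpairs_uniq ?iota_uniq ?divisors_uniq // => -[? ?] [].
  have key i d : d \in divisors n -> logn p (p ^ i * d) = i.
    rewrite -dvdn_divisors // => dn; have d0 := dvdn_gt0 n0 dn.
    rewrite lognM ?expn_gt0 ?p0 // pfactorK // logn_coprime ?addn0 //.
    by rewrite prime_coprime //; apply: contra pn => /dvdn_trans; apply.
  move=> x y /allpairsP[[i d] [_ dn ->]] /allpairsP[[j e] [_ en ->]] /= E.
  have ij : i = j by rewrite -(key i d dn) -(key j e en) E.
  move: E; rewrite -ij => /eqP; rewrite eqn_pmul2l ?expn_gt0 ?p0 // => /eqP ->.
  by rewrite ij.
move=> d; rewrite -dvdn_divisors ?muln_gt0 ?expn_gt0 ?p0 //.
apply/idP/mapP.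
  move=> dpn; have d0 : 0 < d by apply: dvdn_gt0 dpn; rewrite muln_gt0 expn_gt0 p0.
  have [e pe dE] := pfactor_coprime p_pr d0.
  exists (logn p d, e); last by rewrite /= mulnC.
  apply/allpairsP; exists (logn p d, e); split=> //.
    rewrite mem_iota /= add0n ltnS.
    have := dvdn_leq_log p _ dpn; rewrite lognM ?expn_gt0 ?p0 // pfactorK //.
    rewrite [logn p n]logn_coprime ?prime_coprime // addn0; apply.
    by rewrite muln_gt0 expn_gt0 p0.
  rewrite -dvdn_divisors // -(@Gauss_dvdr _ (p ^ k)) ?coprimeXr 1?coprime_sym //.
  by apply: dvdn_trans dpn; rewrite dE dvdn_mulr.
case=> _ /allpairsP[[i e] [+ + ->]] ->.
rewrite mem_iota add0n /= ltnS -dvdn_divisors // => ik en.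
by rewrite dvdn_mul // dvdn_exp2l.
Qed.

(** The involution d -> n / d can fix only a square root of n. *)
Lemma odd_size_divisors n : 0 < n -> odd (size (divisors n)) <-> perfect_square n.
Proof.
move=> n0; have dP d : d \in divisors n -> n %/ d * d = n.
  by rewrite -dvdn_divisors // => /divnK.
have gt0 d : d \in divisors n -> 0 < d by rewrite -dvdn_divisors // => /dvdn_gt0; apply.
rewrite (@odd_size_involution _ (fun d => n %/ d)) ?divisors_uniq //; first last.
- move=> d dn; rewrite -[X in X %/ _](dP d dn) mulKn //.
  by have := dP d dn; have := gt0 d dn; nia.
- by move=> d dn; rewrite -dvdn_divisors // -{2}(dP d dn) dvdn_mulr.
split=> [oc|[k kE]].
  have : has (fun d => n %/ d == d) (divisors n) by rewrite has_count; case: count oc.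
  case/hasP=> d dn /eqP E; exists d; rewrite -[LHS](dP d dn) E; lia.
have kn : k \in divisors n by rewrite -dvdn_divisors // kE dvdn_exp.
rewrite (@eq_in_count _ _ (pred1 k)) ?count_uniq_mem ?divisors_uniq ?kn // => d dn /=.
have := dP d dn; have := gt0 d dn; move: (n %/ d) => e d0 E.
apply/eqP/eqP => [ed|dk]; move: E; rewrite kE ?ed ?dk => /eqP.
  by rewrite mulnn eqn_exp2r // => /eqP.
by rewrite expnS expn1 eqn_pmul2r -?dk // => /eqP.
Qed.

Lemma size_divisors_sqr_lt n : 0 < n -> ~ perfect_square n ->
  size (divisors n) = (count (fun d => d ^ 2 < n) (divisors n)).*2.
Proof.
move=> n0 nsq; rewrite -addnn -(count_predC (fun d => d ^ 2 < n)); congr addn.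
have dP d : d \in divisors n -> n %/ d * d = n.
  by rewrite -dvdn_divisors // => /divnK.
have gt0 d : d \in divisors n -> 0 < d by rewrite -dvdn_divisors // => /dvdn_gt0; apply.
have inv d : d \in divisors n -> n %/ d \in divisors n /\ n %/ (n %/ d) = d.
  move=> dn; rewrite -[X in X %/ (_ %/ _)](dP d dn) mulKn; last first.
    by have := dP d dn; have := gt0 d dn; nia.
  by rewrite -dvdn_divisors // -{2}(dP d dn) dvdn_mulr.
have ne d : d \in divisors n -> d ^ 2 <> n by move=> _ E; case: nsq; exists d.
have cnt P : count P (divisors n) = count (fun d => (d \in divisors n) && P d) (divisors n).
  by apply: eq_in_count => d dn; rewrite dn.
rewrite cnt [RHS]cnt; apply: (@count_bij _ _ (fun d => n %/ d) (fun d => n %/ d));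
  rewrite ?divisors_uniq //.
- by move=> x /andP[].
- by move=> x /andP[].
- move=> d /andP[dn /= le]; have [-> ->] := inv d dn; split=> //=.
  have := dP d dn; have := ne d dn; have := gt0 d dn; nia.
- move=> d /andP[dn /= le]; have [-> ->] := inv d dn; split=> //=.
  have := dP d dn; have := ne d dn; have := gt0 d dn; nia.
Qed.

Lemma even_logn_square n : 0 < n ->
  (forall p, prime p -> ~~ odd (logn p n)) -> perfect_square n.
Proof.
move=> n0 ev; exists (\prod_(p <- primes n) p ^ (logn p n)./2).
rewrite {1}[n]prod_prime_decomp // prime_decompE big_map /=.
rewrite -[RHS]mulnn -big_split /= big_seq [RHS]big_seq; apply: eq_bigr => p.
rewrite mem_primes => /and3P[p_pr _ _]; rewrite -expnD addnn even_halfK //.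
exact: ev.
Qed.

(** * Zagier's involution *)

Lemma perfect_square_logn n p : perfect_square n -> ~~ odd (logn p n).
Proof. by case=> k ->; rewrite lognX oddM. Qed.

Lemma odd_logn_nonsquare n : 0 < n -> ~ perfect_square n ->
  exists2 p, prime p & odd (logn p n).
Proof.
move=> n0 nsq; have [/hasP[p pn op]|/hasPn ev] := boolP (has (fun p => odd (logn p n)) (primes n)).
  by exists p => //; move: pn; rewrite mem_primes => /andP[].
case: nsq; apply: even_logn_square => // p p_pr.
have [/ev //|] := boolP (p \in primes n).
by rewrite -logn_gt0 -eqn0Ngt => /eqP ->.
Qed.

(** Take p with odd exponent k and write n = p ^ k * M with M prime to p. Half the number of
    divisors is (k + 1) / 2 times the number of divisors of M, which is odd iff k = 1 modulo 4 and M
    is a square. *)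
Lemma odd_small_divisors n : 0 < n -> ~ perfect_square n ->
  odd (count (fun d => d ^ 2 < n) (divisors n)) <->
  exists p, [/\ prime p, logn p n = 1 %[mod 4] &
                forall r, prime r -> r <> p -> ~~ odd (logn r n)].
Proof.
move=> n0 nsq; have two_c := size_divisors_sqr_lt n0 nsq.
move: (count _ _) two_c => c two_c.
have split_p p : prime p -> odd (logn p n) -> exists2 M, 0 < M &
    [/\ ~~ (p %| M), n = p ^ logn p n * M,
        forall r, prime r -> r <> p -> logn r M = logn r n &
        c = (logn p n)./2.+1 * size (divisors M)].
  move=> p_pr op; have [M pM nE] := pfactor_coprime p_pr n0.
  move: pM; rewrite prime_coprime // => pM.
  have M0 : 0 < M by lia.
  have nE' : n = p ^ logn p n * M by rewrite mulnC.
  exists M => //; split=> //.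
    move=> r r_pr rp; have pk0 : 0 < p ^ logn p n by rewrite expn_gt0 prime_gt0.
    rewrite [in RHS]nE lognM // lognX (logn_prime r p_pr).
    by rewrite (_ : r == p = false) ?muln0 ?addn0 //; apply/eqP.
  move: two_c; rewrite {1}nE' size_divisors_prime_pow //.
  by have := odd_double_half (logn p n); rewrite op; nia.
split=> [oc|[p [p_pr k1 ev]]].
  have [p p_pr op] := odd_logn_nonsquare n0 nsq.
  have [M M0 [pM nE logM cE]] := split_p p p_pr op.
  exists p; move: oc; rewrite cE oddM => /andP[ok oM]; split=> //.
    by clear -op ok; lia.
  move=> r r_pr rp; rewrite -logM //; apply: perfect_square_logn.
  exact/odd_size_divisors.
have op : odd (logn p n) by clear -k1; lia.
have [M M0 [pM nE logM ->]] := split_p p p_pr op.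
rewrite oddM; apply/andP; split; first by clear -k1; lia.
apply/odd_size_divisors => //; apply: even_logn_square => // r r_pr.
have [->|/eqP rp] := eqVneq r p; last by rewrite logM // ev.
by rewrite lognE p_pr M0 (negPf pM).
Qed.

Definition zagier (t : nat * (nat * nat)) : nat * (nat * nat) :=
  let: (x, (y, z)) := t in
  if x + z < y then (x + 2 * z, (z, y - (x + z)))
  else if x < 2 * y then (2 * y - x, (y, x + z - y))
  else (x - 2 * y, (x + z - y, y)).

Definition windmill n (t : nat * (nat * nat)) :=
  let: (x, (y, z)) := t in x ^ 2 + 4 * (y * z) == n.

(** If y z = 0 then n = x ^ 2 is a square; if x is even then 4 divides n. *)
Lemma windmill_gt0 n x y z : n %% 4 = 1 -> ~ perfect_square n ->
  windmill n (x, (y, z)) -> [/\ odd x, 0 < y & 0 < z].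
Proof.
move=> n1 nsq /eqP E; have yz : 0 < y * z.
  by rewrite lt0n; apply: contra_notN nsq => /eqP yz; exists x; lia.
move: yz; rewrite muln_gt0 => /andP[y0 z0]; split=> //.
by apply/negPn/negP => /sqr_even[k kE]; lia.
Qed.

Lemma windmill_zagier n t : n %% 4 = 1 -> ~ perfect_square n ->
  windmill n t -> windmill n (zagier t) /\ zagier (zagier t) = t.
Proof.
case: t => x [y z] n1 nsq W; have [ox y0 z0] := windmill_gt0 n1 nsq W.
move: W; rewrite /windmill => /eqP E.
(* On the boundary x + z = y the form x ^ 2 + 4 y z becomes (x + 2 z) ^ 2. *)
have ne : x + z <> y.
  by move=> yE; apply: nsq; exists (x + 2 * z); rewrite -E -yE; lia.
rewrite /zagier; case: ifP => h1.
  have [w wE] : exists w, y = x + z + w.+1 by exists (y - (x + z)).-1; lia.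
  split; first by rewrite -E wE; clear; apply/eqP; lia.
  clear E nsq; do ![case: ifP => /= ?]; (congr (_, (_, _)) || exfalso); lia.
case: ifP => h2.
  have [w wE] : exists w, x + z = y + w.+1 by exists (x + z - y).-1; lia.
  split.
    apply/eqP; have -> : x + z - y = w.+1 by lia.
    have [v vE] : exists v, 2 * y = x + v by exists (2 * y - x); lia.
    have -> : 2 * y - x = v by lia.
    rewrite -E; clear -wE vE; nia.
  clear E nsq; do ![case: ifP => /= ?]; (congr (_, (_, _)) || exfalso); lia.
have [w wE] : exists w, x = 2 * y + w by exists (x - 2 * y); lia.
split.
  apply/eqP; have -> : x + z - y = y + w + z by lia.
  have -> : x - 2 * y = w by lia.
  by rewrite -E wE; clear; lia.
clear E nsq; do ![case: ifP => /= ?]; (congr (_, (_, _)) || exfalso); lia.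
Qed.

(* Zagier's involution and the swap of y and z act on the same finite set
   x ^ 2 + 4 y z = n, so their numbers of fixed points agree modulo 2. *)
Lemma odd_count_windmill n L : n %% 4 = 1 -> ~ perfect_square n -> n < L ->
  odd (count (fun x => [&& odd x.1, 0 < x.2 & x.1 ^ 2 + 4 * x.2 ^ 2 == n]) (box L)) =
  odd (count (fun d => d ^ 2 < n) (divisors n)).
Proof.
move=> n1 nsq nL; set s := [seq (x, p) | x <- iota 0 L, p <- box L].
have us : uniq s by rewrite allpairs_uniq ?iota_uniq ?box_uniq // => -[? ?] [? ?] _ _ [-> ->].
have sP t : windmill n t -> t \in s.
  case: t => x [y z] W; have [ox y0 z0] := windmill_gt0 n1 nsq W.
  move: W => /eqP E; apply/allpairsP; exists (x, (y, z)); split=> //.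
    by rewrite mem_iota /=; nia.
  by rewrite mem_box /=; apply/andP; split; nia.
transitivity (odd (count (windmill n) s)).
  rewrite (@odd_count_involution _ (fun t => (t.1, (t.2.2, t.2.1)))) //; last first.
  - by case=> x [y z].
  - by case=> x [y z] /=; rewrite mulnC [z * y]mulnC mulnC.
  congr odd; apply: (@count_bij _ _ (fun x => (x.1, (x.2, x.2))) (fun t => (t.1, t.2.1))) => //.
  - exact: box_uniq.
  - by case=> u v; rewrite mem_box /= => /and3P[ou v0 /eqP E]; nia.
  - by move=> t /andP[/sP].
  - case=> u v /= /and3P[ou v0 /eqP E]; split=> //.
    by rewrite eqxx andbT; apply/eqP; rewrite mulnn.
  - case=> x [y z] /andP[W /=/eqP[zy _]]; have [ox y0 z0] := windmill_gt0 n1 nsq W.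
    by rewrite /= -{3}zy ox y0 /= in W *; rewrite -mulnn; subst z.
rewrite (@odd_count_involution _ zagier) //; first last.
- by move=> t /(windmill_zagier n1 nsq)[].
- by move=> t /(windmill_zagier n1 nsq)[].
have n0 : 0 < n by lia.
rewrite (@eq_in_count _ (fun d => d ^ 2 < n)
  (fun d => (d \in divisors n) && (d ^ 2 < n))); last first.
  by move=> d ->.
congr odd; apply: (@count_bij _ _ (fun t => t.1) (fun d => (d, (d, (n %/ d - d) %/ 4)))) => //.
- exact: divisors_uniq.
- by move=> t /andP[/sP].
- by move=> d /andP[].
- case=> x [y z] /andP[W /eqP Z]; have [ox y0 z0] := windmill_gt0 n1 nsq W.
  (* The outer branches would force z = 0 or y = 0. The middle one gives 2 y - x = x, so n = x (x +
     4 z) and x is a divisor below the square root. *)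
  have xy : x = y.
    by move: Z; rewrite /zagier; clear W nsq; do ![case: ifP => ?]; case; lia.
  subst y; move: W => /eqP E; have nE : n = (x + 4 * z) * x by rewrite -E; lia.
  have x0 : 0 < x by lia.
  split; first by rewrite -dvdn_divisors // nE dvdn_mull //=; nia.
  by rewrite /= nE mulnK //; congr (_, (_, _)); lia.
- move=> d /andP[]; rewrite -dvdn_divisors // => /dvdnP[e nE] dn.
  have d0 : 0 < d by lia.
  have de : d < e by nia.
  (* Since d e = 1 modulo 4, the factors d and e are congruent modulo 4. *)
  have [z zE] : exists z, e = d + 4 * z.
    have od : odd d by have := odd_mod n (erefl : odd 4 = false);
      rewrite n1 nE oddM; case: (odd d); rewrite ?andbF.
    have oe : odd e by have := odd_mod n (erefl : odd 4 = false); rewrite n1 nE oddM; case: (odd e).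
    exists ((e - d) %/ 4).
    have := n1; rewrite nE -modnMm.
    have : d %% 4 = 1 \/ d %% 4 = 3 by clear -od; lia.
    have : e %% 4 = 1 \/ e %% 4 = 3 by clear -oe; lia.
    by case=> e4; case=> d4; rewrite e4 d4 => //= _; clear -de e4 d4; lia.
  have -> : (n %/ d - d) %/ 4 = z by rewrite nE mulnK // zE; lia.
  split=> //; apply/andP; split; first by rewrite /= nE zE; lia.
  by apply/eqP; rewrite /zagier; do ![case: ifP => ?]; (congr (_, (_, _)) || exfalso); lia.
Qed.

(** * Representations by x ^ 2 + y ^ 2 *)

(** With the exponents (x ^ 2 - 1) / 8 of psi and 3 (y ^ 2 - 1) / 24 of f_3, this says that they sum
    to m. *)
Definition two_sqr_rep m (x : nat * nat) :=
  [&& odd x.1, prime_to6 x.2 & x.1 ^ 2 + x.2 ^ 2 == 8 * m + 2].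

Lemma two_sqr_mem_box m L x : 8 * m + 2 < L -> two_sqr_rep m x -> x \in box L.
Proof. by case: x => u v mL; rewrite mem_box => /and3P[/= ou _ /eqP E]; nia. Qed.

(** Here 3 divides 8 m + 2, and a sum of two squares divisible by 3 has both terms divisible by
    3. *)
Lemma count_two_sqr_mod2 m L : m %% 3 = 2 -> count (two_sqr_rep m) (box L) = 0.
Proof.
move=> m3; apply/eqP; rewrite -leqn0 leqNgt -has_count; apply/hasPn => -[u v] _.
apply/negP => /and3P[/= _ /andP[_ /sqr_mod3[k ->]] /eqP E].
by have [/sqr_dvd3[l lE]|/sqr_mod3[l lE]] := boolP (3 %| u); lia.
Qed.

(** As 8 m + 2 = 2 modulo 3, both coordinates are prime to 3 and may be exchanged; a fixed pair (k,
    k) means 4 m + 1 = k ^ 2. *)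
Lemma odd_count_two_sqr_mod0 m L : m %% 3 = 0 -> 8 * m + 2 < L ->
  odd (count (two_sqr_rep m) (box L)) <-> perfect_square (4 * m + 1).
Proof.
move=> m3 mL; rewrite (@odd_count_involution _ (fun x => (x.2, x.1))) ?box_uniq //; last first.
- by case.
- case=> u v /and3P[/= ou /andP[ov v3] /eqP E].
  rewrite /two_sqr_rep /prime_to6 /= ou ov addnC E eqxx andbT /=.
  apply/negP => /sqr_dvd3[k kE]; case: (sqr_mod3 v3) => l lE; lia.
- by move=> x; apply: two_sqr_mem_box.
split=> [oc|[k kE]].
  have : has (fun x => two_sqr_rep m x && ((x.2, x.1) == x)) (box L).
    by rewrite has_count; case: count oc.
  case/hasP => -[u v] _ /andP[/and3P[/= _ _ /eqP E] /eqP[uv _]].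
  by exists u; subst v; lia.
rewrite (@eq_in_count _ _ (pred1 (k, k))) ?count_uniq_mem ?box_uniq //.
  by rewrite mem_box /= andbb; rewrite (_ : k < L) //; nia.
case=> u v _; apply/andP/eqP => [[/and3P[/= _ _ /eqP E] /eqP[uv _]]|[-> ->]].
  subst v; have : u ^ 2 = k ^ 2 by lia.
  by move/eqP; rewrite eqn_exp2r // => /eqP ->.
split=> //; apply/and3P; split=> /=.
- by apply/negPn/negP => /sqr_even[l lE]; lia.
- apply/andP; split; first by apply/negPn/negP => /sqr_even[l lE]; lia.
  by apply/negP => /sqr_dvd3[l lE]; lia.
- by apply/eqP; lia.
Qed.

(** The half sum and half difference of x and y have squares adding to 4 m + 1; the odd one is u,
    the even one 2 v. Conversely u and v are prime to 3, so exactly one of u + 2 v, |u - 2 v| is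
    divisible by 3, and it must be x. *)
Lemma odd_count_two_sqr_mod1 m L : m %% 3 = 1 -> 8 * m + 2 < L ->
  odd (count (two_sqr_rep m) (box L)) =
  odd (count (fun d => d ^ 2 < 4 * m + 1) (divisors (4 * m + 1))).
Proof.
move=> m3 mL; have nsq : ~ perfect_square (4 * m + 1).
  by case=> k; have [/sqr_dvd3[l ->]|/sqr_mod3[l ->]] := boolP (3 %| k); lia.
rewrite -(@odd_count_windmill _ L) //; try lia.
congr odd; apply: (@count_bij _ _
  (fun x => let s := (x.1 + x.2) %/ 2 in let d := (x.1 - x.2 + (x.2 - x.1)) %/ 2 in
            if odd s then (s, d %/ 2) else (d, s %/ 2))
  (fun x => let d := x.1 - 2 * x.2 + (2 * x.2 - x.1) in
            if 3 %| x.1 + 2 * x.2 then (x.1 + 2 * x.2, d) else (d, x.1 + 2 * x.2)));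
  rewrite ?box_uniq //.
- by move=> x; apply: two_sqr_mem_box.
- by case=> u v; rewrite mem_box /= => /and3P[ou v0 /eqP E]; nia.
- case=> x y /and3P[/= ox /andP[oy y3] /eqP E].
  have x3 : 3 %| x.
    by apply/negPn/negP => /sqr_mod3[k kE]; case: (sqr_mod3 y3) => l lE; lia.
  have xy : x <> y by move=> xy; move: y3; rewrite -xy x3.
  have := absdiff_sqr x y; set D := x - y + (y - x) => DE.
  have [d dE] : exists d, D = 2 * d by exists (D %/ 2); lia.
  have [s sE] : exists s, x + y = 2 * s by exists ((x + y) %/ 2); lia.
  have N : s ^ 2 + d ^ 2 = 4 * m + 1.
    have : D ^ 2 + (x + y) ^ 2 = 2 * (x ^ 2 + y ^ 2).
      by move: DE; clear; rewrite sqrnD; lia.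
    rewrite E dE sE !expnMn; clear; lia.
  have sd : odd s (+) odd d by clear -dE sE ox oy; lia.
  have -> : (x + y) %/ 2 = s by rewrite sE mulKn.
  have -> : D %/ 2 = d by rewrite dE mulKn.
  clear E DE nsq; case: ifP => os /=.
    have [v vE] : exists v, d = 2 * v by exists (d %/ 2); clear -sd os; lia.
    have -> : d %/ 2 = v by rewrite vE mulKn.
    split.
      rewrite os -N vE expnMn eqxx andbT /= lt0n; apply/eqP => v0.
      by clear -v0 vE dE xy; lia.
    by clear N; case: ifP => ?; congr pair; lia.
  have [v vE] : exists v, s = 2 * v by exists (s %/ 2); clear -sd os; lia.
  have -> : s %/ 2 = v by rewrite vE mulKn.
  split.
    have -> : odd d by clear -sd os; lia.
    rewrite -N vE expnMn addnC eqxx andbT /= lt0n; apply/eqP => v0.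
    by clear -v0 vE sE ox; lia.
  by clear N; case: ifP => ?; congr pair; lia.
- case=> u v /= /and3P[ou v0 /eqP E].
  have u3 : ~~ (3 %| u).
    apply/negP => /sqr_dvd3[k kE].
    by have [/sqr_dvd3[l lE]|/sqr_mod3[l lE]] := boolP (3 %| v); lia.
  have v3 : ~~ (3 %| v).
    by apply/negP => /sqr_dvd3[k kE]; case: (sqr_mod3 u3) => l lE; lia.
  have := absdiff_sqr u (2 * v); set d := u - 2 * v + (2 * v - u) => D.
  have N : d ^ 2 + (u + 2 * v) ^ 2 = 8 * m + 2.
    by move: D E; clear; rewrite sqrnD expnMn; lia.
  clear E D nsq; rewrite /two_sqr_rep /prime_to6; case: ifP => h /=; (split; last first).
  + by clear N; case: ifP => ?; congr pair; lia.
  + rewrite [X in X == _]addnC N eqxx andbT; clear N; lia.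
  + by clear N; case: ifP => ?; congr pair; lia.
  + rewrite N eqxx andbT; clear N; lia.
Qed.

Lemma odd_count_two_sqr m L : 8 * m + 2 < L ->
  odd (count (two_sqr_rep m) (box L)) <->
    (m = 0 %[mod 3] /\ perfect_square (4 * m + 1)) \/
    (m = 1 %[mod 3] /\
     exists p : nat,
       [/\ prime p,
           logn p (4 * m + 1) = 1 %[mod 4] &
           forall r : nat, prime r -> r <> p -> ~~ odd (logn r (4 * m + 1))]).
Proof.
move=> mL; rewrite mod0n (_ : 1 %% 3 = 1) //.
have : m %% 3 = 0 \/ m %% 3 = 1 \/ m %% 3 = 2 by lia.
case=> [m3|[m3|m3]]; rewrite m3.
- split=> [oc|[[_ sq]|[]//]]; first by left; split=> //; apply/(odd_count_two_sqr_mod0 m3 mL).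
  exact/(odd_count_two_sqr_mod0 m3 mL).
- have nsq : ~ perfect_square (4 * m + 1).
    by case=> k; have [/sqr_dvd3[l ->]|/sqr_mod3[l ->]] := boolP (3 %| k); lia.
  rewrite odd_count_two_sqr_mod1 // odd_small_divisors //; last lia.
  by split=> [?|[[]//|[]//]]; right.
- by rewrite count_two_sqr_mod2 //; split=> // -[][].
Qed.

(** * Theta series modulo 2 *)

Import GRing.Theory.
Local Open Scope ring_scope.

(** * Finite pentagonal number theorem *)

Section Shanks.
Variables (R : comNzRingType) (q : R).

Definition qprod (s n : nat) : R := \prod_(s <= i < n) (1 - q ^+ i.+1).

(* Shanks' finite form of the pentagonal number theorem: the s-th term of
   shanks n.+1 - shanks n telescopes. *)
Definition shanks (n : nat) : R :=
  \sum_(s < n.+1) (-1) ^+ s * (qprod s n * q ^+ (s * n + 'C(s.+1, 2))).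

Lemma shanks_partial k n : (k <= n)%N ->
  \sum_(s < k.+1) ((-1) ^+ s * (qprod s n.+1 * q ^+ (s * n.+1 + 'C(s.+1, 2)))
                   - (-1) ^+ s * (qprod s n * q ^+ (s * n + 'C(s.+1, 2)))) =
  - ((-1) ^+ k * (qprod k n * q ^+ (k.+1 * n.+1 + 'C(k.+1, 2)))).
Proof.
elim: k => [|k IHk] le_kn.
  rewrite big_ord1 /qprod big_nat_recr //= bin_small // !mul0n !mul1n !addn0 !expr0; ring.
rewrite big_ord_recr /= IHk 1?ltnW //.
(* Everything is expressed through [qprod k.+1 n] and one common exponent, which leaves a polynomial
   identity. *)
have -> : qprod k n = (1 - q ^+ k.+1) * qprod k.+1 n by rewrite /qprod big_ltn.
have -> : qprod k.+1 n.+1 = qprod k.+1 n * (1 - q ^+ n.+1).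
  by rewrite /qprod big_nat_recr.
have -> : (k.+1 * n + 'C(k.+2, 2) = k.+1 * n.+1 + 'C(k.+1, 2))%N.
  by rewrite binS bin1; lia.
have -> : (k.+2 * n.+1 + 'C(k.+2, 2) = k.+1 * n.+1 + 'C(k.+1, 2) + k.+1 + n.+1)%N.
  by rewrite binS bin1; lia.
have -> : (k.+1 * n.+1 + 'C(k.+2, 2) = k.+1 * n.+1 + 'C(k.+1, 2) + k.+1)%N.
  by rewrite binS bin1; lia.
rewrite !(exprD q) (exprS (-1)).
move: (q ^+ (_ * _)) (q ^+ 'C(_, _)) (q ^+ k.+1) (q ^+ n.+1) (qprod _ _) ((-1) ^+ k).
move=> w x y z d e; ring.
Qed.

(** With N = n + 1 the exponents are N (3 N - 1) / 2 and N (3 N + 1) / 2. The first is left by the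
    telescoping sum at k = n, the second is the additional last term. *)
Lemma shanksS n :
  shanks n.+1 = shanks n + (-1) ^+ n.+1 * (q ^+ (n.+1 ^ 2 + 'C(n.+1, 2))
                                         + q ^+ (n.+1 ^ 2 + 'C(n.+2, 2))).
Proof.
rewrite /shanks big_ord_recr /=; apply/eqP; rewrite -subr_eq0; apply/eqP.
have := shanks_partial (leqnn n); rewrite sumrB => /eqP; rewrite subr_eq => /eqP ->.
have qprodnn k : qprod k k = 1 by rewrite /qprod big_geq.
rewrite !qprodnn !mulnn (exprS (-1)).
set S := \sum_(_ < _) _; move: S ((-1) ^+ n) (q ^+ _) (q ^+ _) => S e x y; ring.
Qed.

End Shanks.

(** * Congruence modulo a power of X, standing in for power series *)

Section Congruence.
Variable F : fieldType.
Implicit Types p q r : {poly F}.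

Definition eqX K p q := 'X^K %| p - q.

Lemma eqXX K p : eqX K p p. Proof. by rewrite /eqX subrr dvdp0. Qed.

Lemma eqX_sym K p q : eqX K p q -> eqX K q p.
Proof. by rewrite /eqX -opprB dvdpNr. Qed.

Lemma eqX_trans K q p r : eqX K p q -> eqX K q r -> eqX K p r.
Proof. by move=> pq qr; rewrite /eqX -(subrKA q) dvdp_add. Qed.

Lemma eqXM K p p' q q' : eqX K p p' -> eqX K q q' -> eqX K (p * q) (p' * q').
Proof.
move=> pp qq; rewrite /eqX (_ : _ - _ = (p - p') * q + p' * (q - q')); last by ring.
by apply: dvdp_add; [apply: dvdp_mulr | apply: dvdp_mull].
Qed.

Lemma eqX_prod K n (f g : 'I_n -> {poly F}) :
  (forall i, eqX K (f i) (g i)) -> eqX K (\prod_i f i) (\prod_i g i).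
Proof. by move=> fg; elim/big_ind2: _ => // [|*]; [apply: eqXX | apply: eqXM]. Qed.

Lemma eqX_leq K M p q : (K <= M)%N -> eqX M p q -> eqX K p q.
Proof. by move=> KM; apply: dvdp_trans; rewrite dvdp_exp2l. Qed.

Lemma eqXP K p q : reflect (forall i, (i < K)%N -> p`_i = q`_i) (eqX K p q).
Proof.
apply: (iffP idP) => [/dvdpP[r rE] i iK|pq].
  by apply/eqP; rewrite -subr_eq0 -coefB rE coefMXn iK.
rewrite /eqX -[p - q](poly_take_drop K) dvdp_add ?dvdp_mull //.
rewrite (_ : take_poly K _ = 0) ?dvdp0 //; apply/polyP => i.
by rewrite coef_take_poly coef0; case: ifP => // iK; rewrite coefB pq // subrr.
Qed.

Lemma eqX_comp K k p q : (0 < k)%N -> eqX K p q -> eqX K (p \Po 'X^k) (q \Po 'X^k).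
Proof.
move=> k0 /dvdpP[r rE]; rewrite /eqX -comp_polyB rE comp_polyM comp_Xn_poly -exprM.
by rewrite dvdp_mull // dvdp_exp2l // leq_pmull.
Qed.

(** A polynomial with nonzero constant term is coprime to every power of X. *)
Lemma eqX_cancel K p q r : r`_0 != 0 -> eqX K (p * r) (q * r) -> eqX K p q.
Proof.
move=> r0; rewrite /eqX -mulrBl Gauss_dvdpl //.
rewrite coprimep_expl // coprimep_sym (_ : 'X = 'X - 0%:P); last by rewrite polyC0 subr0.
by rewrite coprimep_XsubC /root horner_coef0.
Qed.

End Congruence.

(** * Pentagonal and triangular series over the field with two elements *)

Notation polyF2 := {poly 'F_2}.

Lemma natF2 n : n%:R = (odd n)%:R :> 'F_2.
Proof. by apply/val_inj; rewrite /= !val_Fp_nat // modn2 [in RHS]modn2; case: (odd n). Qed.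

Lemma natF2_eq m n : (m%:R == n%:R :> 'F_2) = (odd m == odd n).
Proof. by rewrite (natF2 m) (natF2 n); case: (odd m); case: (odd n). Qed.

Lemma polyF2_2 : 2%:R = 0 :> polyF2.
Proof.
by rewrite -polyC_natr -[2%:R]/(1 + 1) (_ : 1 + 1 = 0 :> 'F_2) ?polyC0 //; apply: val_inj.
Qed.

Lemma polyF2_N1 : - 1 = 1 :> polyF2.
Proof. by apply/eqP; rewrite eq_sym -subr_eq0 opprK -[1 + 1]/(2%:R) polyF2_2. Qed.

Definition euler n : polyF2 := \prod_(i < n) (1 - 'X^(i.+1)).

Definition pent u := ((u ^ 2).-1 %/ 24)%N.
Definition tri v := ((v ^ 2).-1 %/ 8)%N.

Lemma pentE u : prime_to6 u -> (u ^ 2 = 24 * pent u + 1)%N.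
Proof.
case/andP=> /sqr_odd_mod8[k kE] /sqr_mod3[l lE]; rewrite /pent; lia.
Qed.

Lemma triE v : odd v -> (v ^ 2 = 8 * tri v + 1)%N.
Proof. by case/sqr_odd_mod8=> k kE; rewrite /tri; lia. Qed.

Definition theta L : polyF2 := \sum_(u <- iota 0 L | prime_to6 u) 'X^(pent u).
Definition psi L : polyF2 := \sum_(v <- iota 0 L | odd v) 'X^(tri v).

Lemma prime_to6_mod n k : prime_to6 (6 * n + k) = prime_to6 k.
Proof. rewrite /prime_to6; lia. Qed.

(** Passing from n to n + 1 adds six values of u, of which 6 n + 5 and 6 n + 7 are prime to 6; their
    pentagonal numbers are the exponents in [shanksS], and signs vanish modulo 2. *)
Lemma theta_shanks n : theta (6 * n + 2) = shanks 'X n.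
Proof.
elim: n => [|n IHn].
  rewrite /theta /shanks !big_cons big_nil big_ord1 /qprod big_geq //=.
  by rewrite addr0 !mul1r.
rewrite shanksS -{}IHn polyF2_N1 expr1n mul1r /theta.
rewrite (_ : 6 * n.+1 + 2 = 6 * n + 2 + 6)%N; last by lia.
rewrite iotaD big_cat /= add0n; congr (_ + _).
rewrite !big_cons big_nil -!addnS !prime_to6_mod /= addr0.
have binE : ('C(n.+1, 2) * 2 = n * n.+1)%N.
  by rewrite bin2 /= muln2 mulnC even_halfK // oddM oddS andbN.
have bin2E : ('C(n.+2, 2) = n.+1 + 'C(n.+1, 2))%N by rewrite binS bin1 addnC.
rewrite bin2E; move: binE; move: 'C(_, _) => b binE.
by congr ('X^_ + 'X^_); rewrite /pent; lia.
Qed.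

(** The term s = 0 of [shanks] is the Euler product; for s > 0 the exponent s n + s (s + 1) / 2 is
    at least n + 1. *)
Lemma euler_theta n : eqX n.+1 (euler n) (theta (6 * n + 2)).
Proof.
rewrite theta_shanks /shanks big_ord_recl /= expr0 mul1r.
rewrite mul0n bin_small // expr0 mulr1 /qprod big_mkord -/(euler n).
rewrite /eqX opprD addrA subrr add0r dvdpNr.
elim/big_ind: _ => [|p q dp dq|i _]; first by rewrite dvdp0.
  exact: dvdp_add.
rewrite mulrA dvdp_mull // dvdp_exp2l //.
by rewrite /bump /= binS bin1; lia.
Qed.

Lemma comp_sumX (P : pred nat) (h : nat -> nat) s k :
  (\sum_(u <- s | P u) 'X^(h u) : polyF2) \Po 'X^k = \sum_(u <- s | P u) 'X^(k * h u).
Proof. by rewrite raddf_sum; apply: eq_bigr => u _; rewrite /= comp_Xn_poly exprM. Qed.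

Lemma coef_sumX (P : pred nat) (h : nat -> nat) s n :
  (\sum_(u <- s | P u) 'X^(h u) : polyF2)`_n = (count (fun u => P u && (h u == n)) s)%:R.
Proof.
rewrite coef_sum -sum1_count natr_sum [RHS]big_mkcondr; apply: eq_bigr => u _.
by rewrite coefXn eq_sym; case: eqP.
Qed.

Lemma coef_sumXM (P Q : pred nat) (h g : nat -> nat) L n :
  ((\sum_(u <- iota 0 L | P u) 'X^(h u)) * (\sum_(v <- iota 0 L | Q v) 'X^(g v)) : polyF2)`_n =
  (count (fun x => [&& P x.1, Q x.2 & h x.1 + g x.2 == n]) (box L))%:R.
Proof.
rewrite -sum1_count natr_sum [RHS]big_mkcond /= /box big_allpairs mulr_suml coef_sum.
rewrite [LHS]big_mkcond.
apply: eq_bigr => u _; case: (P u); last by rewrite big1.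
rewrite mulr_sumr coef_sum [LHS]big_mkcond; apply: eq_bigr => v _ /=.
by case: (Q v) => //=; rewrite -exprD coefXn eq_sym; case: eqP.
Qed.

(** This is f_1 psi = f_4. The coefficient at i on the left counts u ^ 2 + 3 v ^ 2 = 4 (6 i + 1); by
    [odd_count_eis] its parity is that of the number of odd u with u ^ 2 = 6 i + 1, that is, 4
    [pent u] = i. *)
Lemma theta_psi K : eqX K (theta (6 * K + 2) * psi (6 * K + 2)) (theta (6 * K + 2) \Po 'X^4).
Proof.
apply/eqXP => i iK; rewrite comp_sumX coef_sumXM coef_sumX; apply/eqP; rewrite natF2_eq.
rewrite (@eq_count _ _ (odd_eis_rep (6 * i + 1))); last first.
  case=> u v; rewrite /odd_eis_rep /=; apply/idP/idP.
    case/and3P=> cu ov /eqP E; rewrite ov (andP cu).1 /=; apply/eqP.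
    by rewrite (pentE cu) (triE ov) -E; lia.
  case/and3P=> ou ov /eqP E; rewrite ov /=.
  have cu : prime_to6 u.
    by rewrite /prime_to6 ou; apply/negP => /sqr_dvd3[k kE]; lia.
  rewrite cu /=; apply/eqP; have := pentE cu; have := triE ov; lia.
rewrite (@odd_count_eis _ (6 * i + 1)); [|nia|lia].
apply/eqP; congr odd; apply: eq_count => u; apply/idP/idP.
  case/andP=> ou /eqP E; have [k kE] := sqr_odd_mod8 ou.
  have cu : prime_to6 u by rewrite /prime_to6 ou; apply/negP => /sqr_dvd3[l lE]; lia.
  by rewrite cu /=; have := pentE cu; lia.
by case/andP=> cu /eqP E; rewrite (andP cu).1 /= (pentE cu) -E; lia.
Qed.

(** * Extraction of the exponents congruent to 1 modulo 4 *)

Definition sect41 (p : polyF2) : polyF2 := \poly_(i < size p) p`_(4 * i + 1).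

Lemma coef_sect41 p i : (sect41 p)`_i = p`_(4 * i + 1).
Proof.
rewrite coef_poly; case: ltnP => // le; rewrite nth_default //.
by apply: leq_trans le _; lia.
Qed.

Lemma sect41M p q : sect41 (p * (q \Po 'X^4)) = sect41 p * q.
Proof.
apply/polyP => i; rewrite coef_sect41 comp_polyE.
have qE : q = \sum_(k < size q) q`_k *: 'X^k by rewrite -poly_def coefK.
rewrite [in RHS]qE !mulr_sumr !coef_sum.
apply: eq_bigr => k _; rewrite -!scalerAr !coefZ -exprM !coefMXn coef_sect41.
congr (_ * _); have -> : (4 * i + 1 < 4 * k)%N = (i < k)%N by lia.
by case: ifP => // ik; congr (p`_ _); lia.
Qed.

Lemma eqX_sect41 K p q : eqX (4 * K) p q -> eqX K (sect41 p) (sect41 q).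
Proof. by move/eqXP=> pq; apply/eqXP => i iK; rewrite !coef_sect41 pq //; lia. Qed.

(** The exponent 4 i + 1 in f_1 f_3 corresponds to u ^ 2 + 3 v ^ 2 = 4 (24 i + 7) with u, v prime to
    6, and the exponent i in f_4 f_3 to 4 s ^ 2 + 3 t ^ 2 = 24 i + 7. [odd_count_eis_prime_to6]
    compares the two counts. *)
Lemma sect41_theta K : eqX K
  (sect41 (theta (24 * K + 2) * (theta (24 * K + 2) \Po 'X^3)))
  ((theta (24 * K + 2) \Po 'X^4) * (theta (24 * K + 2) \Po 'X^3)).
Proof.
apply/eqXP => i iK; rewrite coef_sect41 !comp_sumX !coef_sumXM; apply/eqP; rewrite natF2_eq.
rewrite (@eq_count _ _ (fun x => odd_eis_rep (24 * i + 7) x && ~~ (3 %| x.2)%N)); last first.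
  case=> u v; rewrite /odd_eis_rep /=; apply/idP/idP.
    case/and3P=> cu cv /eqP E; case/andP: (cv) => -> ->; rewrite (andP cu).1 /= andbT.
    by apply/eqP; rewrite (pentE cu) (pentE cv); lia.
  case/andP=> /and3P[ou ov /eqP E] v3; have cv : prime_to6 v by rewrite /prime_to6 ov.
  have cu : prime_to6 u.
    by rewrite /prime_to6 ou; apply/negP => /sqr_dvd3[k kE]; lia.
  by rewrite cu cv /=; apply/eqP; have := pentE cu; have := pentE cv; lia.
rewrite odd_count_eis_prime_to6; last by nia.
apply/eqP; congr odd; apply: eq_count => -[s t]; rewrite /eis_half_rep /=; apply/idP/idP.
  case/andP=> ct /eqP E; rewrite ct; have tE := pentE ct.
  have cs : prime_to6 s.
    rewrite /prime_to6; apply/andP; split; last by apply/negP => /sqr_dvd3[k kE]; lia.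
    by apply/negPn/negP => /sqr_even[k kE]; lia.
  by rewrite cs /=; apply/eqP; have := pentE cs; lia.
by case/and3P=> cs ct /eqP E; rewrite ct /= (pentE cs) (pentE ct); apply/eqP; lia.
Qed.

Lemma euler_comp k n : euler n \Po 'X^k = \prod_(i < n) (1 - 'X^(k * i.+1)).
Proof.
rewrite /euler rmorph_prod; apply: eq_bigr => i _.
by rewrite rmorphB rmorph1 /= comp_Xn_poly exprM.
Qed.

Lemma euler_exp4 n : euler n ^+ 4 = euler n \Po 'X^4.
Proof.
rewrite euler_comp -prodrXl; apply: eq_bigr => i _.
rewrite mulnC exprM; move: ('X^_) => x.
have -> : (1 - x) ^+ 4 = 1 - x ^+ 4 +
  2%:R * (x ^+ 4 - 2%:R * x ^+ 3 + 3%:R * x ^+ 2 - 2%:R * x) by ring.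
by rewrite polyF2_2 mul0r addr0.
Qed.

Lemma euler_coef0 n : (euler n)`_0 != 0.
Proof.
rewrite -horner_coef0 /euler horner_prod big1 ?oner_neq0 // => i _.
by rewrite !hornerE /= expr0n subr0.
Qed.

(** * The generating function *)

Definition zero_or_odd (j : nat) := odd j || (j == 0)%N.

Definition odd_mult_gf K : polyF2 := \prod_(i < K) \sum_(j < K.+1 | zero_or_odd j) 'X^(i.+1 * j).

(** Modulo 2, 1 + x / (1 - x ^ 2) is (1 + x + x ^ 2) / (1 - x) ^ 2. The last term is the truncation
    error, its exponent being the first odd number above K. *)
Lemma odd_mult_gf_factor (x : polyF2) K :
  (1 - x) ^+ 2 * (\sum_(j < K.+1 | zero_or_odd j) x ^+ j) = 1 + x + x ^+ 2 + x ^+ (K.+1 + odd K).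
Proof.
have sqE : (1 - x) ^+ 2 = 1 + x ^+ 2.
  rewrite (_ : (1 - x) ^+ 2 = 1 + x ^+ 2 - 2%:R * x); last by ring.
  by rewrite polyF2_2 mul0r subr0.
elim: K => [|K IHK].
  rewrite big_mkcond big_ord1 /= expr0 mulr1 sqE addn0 expr1.
  rewrite (_ : 1 + x + x ^+ 2 + x = 1 + x ^+ 2 + 2%:R * x); last by ring.
  by rewrite polyF2_2 mul0r addr0.
rewrite big_mkcond big_ord_recr -big_mkcond /= mulrDr IHK /zero_or_odd /= orbF.
case oK: (odd K); rewrite /= ?mulr0 ?addr0 ?addn0 ?addn1 // sqE.
rewrite mulrDl mul1r -exprD -addrA.
rewrite (_ : x ^+ K.+1 + _ = x ^+ (2 + K.+1) + 2%:R * x ^+ K.+1); last by ring.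
by rewrite polyF2_2 mul0r addr0 add2n.
Qed.

(** The third factor 1 - x turns 1 + x + x ^ 2 into 1 - x ^ 3; the truncation error has order above
    K. *)
Lemma odd_mult_gf_euler K : eqX K.+1 (odd_mult_gf K * euler K ^+ 3) (euler K \Po 'X^3).
Proof.
rewrite euler_comp /euler -prodrXl /odd_mult_gf -big_split /=; apply: eqX_prod => i.
have -> : \sum_(j < K.+1 | zero_or_odd j) 'X^(i.+1 * j) =
          \sum_(j < K.+1 | zero_or_odd j) ('X^(i.+1) : polyF2) ^+ j.
  by apply: eq_bigr => j _; rewrite exprM.
rewrite mulrC exprS -mulrA odd_mult_gf_factor mulnC exprM.
rewrite (_ : _ * _ = 1 - ('X^(i.+1) : polyF2) ^+ 3 +
  (1 - 'X^(i.+1)) * 'X^(i.+1) ^+ (K.+1 + odd K)); last by ring.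
rewrite /eqX addrC addKr -exprM dvdp_mull // dvdp_exp2l //; lia.
Qed.

Lemma sumn_count_mem K s : all (fun x => 0 < x <= K)%N s ->
  sumn s = (\sum_(i < K) i.+1 * count_mem i.+1 s)%N.
Proof.
elim: s => [_|x s IHs] /=; first by rewrite big1 // => i _; rewrite muln0.
case/andP=> /andP[x0 xK] /IHs ->; under [RHS]eq_bigr do rewrite mulnDr.
rewrite [RHS]big_split; congr (_ + _)%N; have x1 : (x.-1 < K)%N by lia.
rewrite (bigD1 (Ordinal x1)) //= prednK // eqxx muln1 big1 ?addn0 // => i ni.
suff -> : (x == i.+1) = false by rewrite muln0.
apply: contraNF ni => /eqP xi; apply/eqP/val_inj; rewrite /= xi //.
Qed.

Lemma partition_parts n s : is_partition n s ->
  [/\ all (fun x => 0 < x <= n)%N s & forall x, (count_mem x s <= n)%N].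
Proof.
case/and3P=> _ s0 /eqP <-; split.
  elim: s s0 => //= x s IHs /andP[-> /IHs s0]; rewrite leq_addr /=.
  by apply: sub_all s0 => y /andP[-> yn] /=; apply: leq_trans yn (leq_addl _ _).
move=> x; apply: leq_trans (count_size _ _) _.
by elim: s s0 => //= y s IHs /andP[y0 /IHs]; lia.
Qed.

Section PartitionsAsMultiplicities.
Variables (n K : nat).
Hypothesis nK : (n <= K)%N.

(** The bound K >= n is left free so that a single product [odd_mult_gf K] yields all coefficients
    up to K. *)
Definition mults (t : n.-bseq 'I_n.+1) : {ffun 'I_K -> 'I_K.+1} :=
  [ffun i : 'I_K => inord (count_mem i.+1 (map val t))].

Lemma multsE (t : n.-bseq 'I_n.+1) (i : 'I_K) : is_partition n (map val t) ->
  mults t i = count_mem i.+1 (map val t) :> nat.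
Proof.
case/partition_parts=> _ cn; rewrite ffunE inordK // ltnS.
exact: leq_trans (cn _) nK.
Qed.

Definition parts_of (f : {ffun 'I_K -> 'I_K.+1}) : seq nat :=
  sort geq (flatten [seq nseq (f i) i.+1 | i <- enum 'I_K]).

Lemma count_parts_of f (i : 'I_K) : count_mem i.+1 (parts_of f) = f i.
Proof.
rewrite count_sort count_flatten -map_comp sumnE big_map big_enum /=.
rewrite (bigD1 i) //= count_nseq /= eqxx mul1n big1 ?addn0 // => j ji.
rewrite count_nseq /= eqSS; suff -> : (j == i :> nat) = false by [].
exact: negbTE.
Qed.

Lemma parts_of_bounds f : all (fun x => 0 < x <= K)%N (parts_of f).
Proof.
rewrite all_sort; apply/allP=> x /flattenP[_ /mapP[i _ ->]].
by rewrite mem_nseq => /andP[_ /eqP ->] /=.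
Qed.

(** A sorted list is determined by its multiplicities, so [mults] is injective on partitions;
    [parts_of] provides preimages. *)
Lemma card_mults :
  a n = #|[set f : {ffun 'I_K -> 'I_K.+1} |
     [forall i, zero_or_odd (f i)] && (\sum_(i < K) i.+1 * f i == n)%N]|.
Proof.
rewrite /a -(@card_in_imset _ _ mults); last first.
  move=> t u; rewrite !inE => /andP[pt _] /andP[pu _] E.
  apply/val_inj/(inj_map val_inj).
  have [[st t0 _] [su u0 _]] := (and3P pt, and3P pu).
  apply: (@sorted_eq _ geq) => //.
  - by move=> y x z xy yz; apply: leq_trans yz xy.
  - by move=> x y /anti_leq.
  apply/allP => x _ /=; apply/eqP.
  have [[bt _] [bu _]] := (partition_parts pt, partition_parts pu).
  have [xK|xK] := boolP (0 < x <= K)%N; last first.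
    have no s : all (fun x => 0 < x <= n)%N s -> count_mem x s = 0%N.
      move=> bs; apply/count_memPn; apply: contra xK => /(allP bs) /andP[-> xn].
      exact: leq_trans xn nK.
    by rewrite !no.
  have x1 : (x.-1 < K)%N by lia.
  have := congr1 (fun f : {ffun 'I_K -> 'I_K.+1} => f (Ordinal x1) : nat) E.
  by rewrite /= !multsE //= prednK //; lia.
congr #|pred_of_set _|; apply/setP => f; rewrite inE; apply/imsetP/idP.
  case=> t; rewrite inE => /andP[pt ot] ->.
  have [bt _] := partition_parts pt; apply/andP; split.
    apply/forallP => i; rewrite multsE // /zero_or_odd.
    have [im|/count_memPn ->] := boolP (i.+1 \in map val t); last by rewrite orbT.
    by rewrite (allP ot).
  under eq_bigr do rewrite multsE //.
  rewrite -sumn_count_mem; first by case/and3P: pt.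
  by apply: sub_all bt => x /andP[-> xn]; apply: leq_trans xn nK.
case/andP=> /forallP zf /eqP fn.
have bf := parts_of_bounds f.
have pf : is_partition n (parts_of f).
  apply/and3P; split.
  - by apply: sort_sorted => x y; apply: leq_total.
  - by apply: sub_all bf => x /andP[].
  - rewrite (sumn_count_mem bf) -fn; apply/eqP; apply: eq_bigr => i _.
    by rewrite count_parts_of.
have [t tE] := partition_bounded pf; exists t.
  rewrite inE tE pf /=; apply/allP => x xf.
  have /andP[x0 xK] := allP bf x xf.
  have x1 : (x.-1 < K)%N by lia.
  have := zf (Ordinal x1); rewrite -count_parts_of /= prednK // /zero_or_odd.
  by rewrite -[(_ == 0)%N]negbK -lt0n -has_count has_pred1 xf orbF.
by apply/ffunP => i; apply/val_inj; rewrite /= multsE tE // count_parts_of.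
Qed.

Lemma coef_odd_mult_gf : (odd_mult_gf K)`_n = (a n)%:R.
Proof.
rewrite /odd_mult_gf bigA_distr_big /= card_mults coef_sum -sum1_card natr_sum.
rewrite big_mkcond [RHS]big_mkcond; apply: eq_bigr => f _.
rewrite inE (_ : (f \in ffun_on _) = [forall i, zero_or_odd (f i)]); last first.
  by apply/ffun_onP/forallP.
case: forallP => //= _; rewrite -(big_morph _ (@exprD _ 'X) (expr0 'X)) coefXn.
by rewrite eq_sym; case: eqP.
Qed.

End PartitionsAsMultiplicities.

Lemma odd_a_two_sqr m :
  odd (a (4 * m + 1)) = odd (count (two_sqr_rep m) (box (24 * m.+1 + 2))).
Proof.
(* Precision 4 (m + 1) survives the extraction as precision m + 1, which covers the coefficient at
   m. *)
set E := (4 * m.+1)%N; set e := euler E.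
have LE : (24 * m.+1 + 2 = 6 * E + 2)%N by rewrite /E; lia.
set L := (24 * m.+1 + 2)%N in LE *; set e3 := e \Po 'X^3.
have eT : eqX E e (theta L) by rewrite LE; apply: eqX_leq (euler_theta E).
have e0 : e`_0 != 0 := euler_coef0 E.
have eT3 : eqX E e3 (theta L \Po 'X^3) by apply: eqX_comp.
(* Both sides become f_4 after multiplication by f_1. *)
have psiE : eqX E (psi L) (e ^+ 3).
  apply: (eqX_cancel e0); rewrite -exprSr euler_exp4 -/e mulrC.
  apply: eqX_trans (eqX_comp _ (eqX_sym eT)) => //.
  by apply: eqX_trans (eqXM eT (eqXX _ _)) _; rewrite LE; apply: theta_psi.
(* The generating function f_3 / f_1^3 times f_4 = f_1^4 is f_1 f_3. *)
have genE : eqX E (odd_mult_gf E * (e \Po 'X^4)) (theta L * (theta L \Po 'X^3)).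
  rewrite -euler_exp4 -/e exprSr mulrA [theta L * _]mulrC.
  apply: eqXM eT; apply: eqX_trans eT3; apply: eqX_leq (odd_mult_gf_euler E).
  exact: leqnSn.
have mE : (m.+1 <= E)%N by rewrite /E; lia.
(* Extraction turns the factor f_4 into f_1 on the left and gives f_4 f_3 = f_1 psi f_3 on the
   right; f_1 cancels. *)
have extE : eqX m.+1 (sect41 (odd_mult_gf E)) (psi L * (theta L \Po 'X^3)).
  apply: (eqX_cancel e0); rewrite -sect41M; apply: eqX_trans (eqX_sect41 genE) _.
  apply: eqX_trans (sect41_theta _) _; rewrite -/L mulrAC; apply: eqXM (eqXX _ _).
  apply: (eqX_leq mE); apply: eqX_sym; rewrite LE mulrC.
  by apply: eqX_trans (eqXM eT (eqXX _ _)) _; rewrite LE; apply: theta_psi.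
have := eqXP _ _ _ extE m (ltnSn m); rewrite coef_sect41 coef_odd_mult_gf; last by rewrite /E; lia.
rewrite comp_sumX coef_sumXM => /eqP; rewrite natF2_eq => /eqP ->.
congr odd; apply: eq_count => -[x y]; rewrite /two_sqr_rep /=.
case ox: (odd x) => //; case cy: (prime_to6 y) => //=.
by rewrite (triE ox) (pentE cy); apply/eqP/eqP; lia.
Qed.

Local Close Scope ring_scope.

Theorem theorem2p3 (m : nat) :
  odd (a (4 * m + 1)) <->
    (m = 0 %[mod 3] /\ perfect_square (4 * m + 1)) \/
    (m = 1 %[mod 3] /\
     exists p : nat,
       [/\ prime p,
           logn p (4 * m + 1) = 1 %[mod 4] &
           forall r : nat, prime r -> r <> p -> ~~ odd (logn r (4 * m + 1))]).
Proof. by rewrite odd_a_two_sqr; apply: odd_count_two_sqr; lia. Qed.
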